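(* Assume $\lambda(x,x)=1$ for all $x\in\Gamma$. Let $\mathcal{A}$ be a $(\Gamma,\lambda)$-commutative algebra, $\varsigma\in\mathfrak{S}(\lambda)$, $\boldsymbol{\nu}\in\Gamma^n$ and let $X\in\mathsf{M}^x(\boldsymbol{\nu};\mathcal{A})$ be a homogeneous matrix of degree $x\in\Gamma$. Then $X$ is invertible if and only if $\Gamma\!\det_\varsigma(X)$ is invertible in $\mathcal{A}$.
   Context: $\mathbb{K}$ is a field of characteristic zero and $\Gamma$ is a finitely generated abelian group. $\lambda:\Gamma\times\Gamma\to\mathbb{K}^\times$ is a commutation factor: biadditive with $\lambda(x,y)\lambda(y,x)=1$. A $(\Gamma,\lambda)$-commutative algebra is an associative unital $\Gamma$-graded $\mathbb{K}$-algebra $\mathcal{A}=\bigoplus_\gamma\mathcal{A}^\gamma$ with $ab=\lambda(\tilde a,\tilde b)ba$ for homogeneous $a,b$ ($\tilde a$ is the degree). In the purely even case ($\lambda(x,x)=1$ for all $x$), $\mathfrak{S}(\lambda)$ is the set of biadditive maps $\varsigma:\Gamma\times\Gamma\to\mathbb{K}^\times$ with $\lambda(x,y)\varsigma(x,y)\varsigma(y,x)^{-1}=1$. For $\varsigma\in\mathfrak{S}(\lambda)$, $\underline{\mathcal{A}}$ is the vector space $\mathcal{A}$ with the commutative product $a\star b=\varsigma(\tilde a,\tilde b)ab$. $\mathsf{M}^x(\boldsymbol{\nu};\mathcal{A})$ is the set of $n\times n$ matrices over $\mathcal{A}$ with $X^i_{\ j}\in\mathcal{A}^{x-\nu_i+\nu_j}$.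 For such $X$, $J_\varsigma(X)$ is the matrix over $\underline{\mathcal{A}}$ with entries $\varsigma(x,\nu_j)\varsigma(\nu_i,x-\nu_i+\nu_j)^{-1}X^i_{\ j}$, and $\Gamma\!\det_\varsigma(X)=\det_{\underline{\mathcal{A}}}(J_\varsigma(X))$, regarded as an element of $\mathcal{A}$. *)

(* Defs.v *)
From HB Require Import structures.
From mathcomp Require Import all_boot all_order all_algebra.

Set Implicit Arguments.
Unset Strict Implicit.
Unset Printing Implicit Defensive.

Import GRing.Theory.
Local Open Scope ring_scope.

(* Associative unital K-algebras. [algType] extends [nzRingType] and so excludes
   the zero algebra; [pzAlgType] allows it. *)
HB.mixin Record Lmodule_isPzAlgebra (K : pzRingType) A
    of GRing.Lmodule K A := {
  pzmul : A -> A -> A;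
  pzone : A;
  pzmulA : associative pzmul;
  pzmul1l : left_id pzone pzmul;
  pzmul1r : right_id pzone pzmul;
  pzmulDl : left_distributive pzmul +%R;
  pzmulDr : right_distributive pzmul +%R;
  pzmulZl : forall (k : K) (a b : A), k *: pzmul a b = pzmul (k *: a) b;
  pzmulZr : forall (k : K) (a b : A), k *: pzmul a b = pzmul a (k *: b)
}.

#[short(type="pzAlgType")]
HB.structure Definition PzAlgebra (K : pzRingType) :=
  {A of GRing.Lmodule K A & Lmodule_isPzAlgebra K A}.

HB.instance Definition _ (K : pzRingType) (A : pzAlgType K) :=
  GRing.Zmodule_isPzRing.Build (PzAlgebra.sort A)
    pzmulA pzmul1l pzmul1r pzmulDl pzmulDr.

HB.instance Definition _ (K : pzRingType) (A : algType K) :=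
  Lmodule_isPzAlgebra.Build K A
    (@mulrA A) (@mul1r A) (@mulr1 A) (@mulrDl A) (@mulrDr A)
    (@scalerAl K A) (@scalerAr K A).

Lemma pzscalerAl (K : pzRingType) (A : pzAlgType K) (k : K) (a b : A) :
  k *: (a * b) = (k *: a) * b.
Proof. exact: pzmulZl. Qed.

Lemma pzscalerAr (K : pzRingType) (A : pzAlgType K) (k : K) (a b : A) :
  k *: (a * b) = a * (k *: b).
Proof. exact: pzmulZr. Qed.

Definition fin_gen (Gamma : zmodType) : Prop :=
  exists (m : nat) (g : 'I_m -> Gamma),
    forall x, exists c : 'I_m -> int, x = \sum_i g i *~ c i.

Section Factors.
Variables (Gamma : zmodType) (K : fieldType).
Implicit Types f lambda sigma : Gamma -> Gamma -> K.

Definition biadditive f : Prop :=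
  [/\ forall x y, f x y != 0,
      forall x y z, f (x + y) z = f x z * f y z
    & forall x y z, f x (y + z) = f x y * f x z].

Definition commutation_factor lambda : Prop :=
  biadditive lambda /\ forall x y, lambda x y * lambda y x = 1.

Definition frakS lambda sigma : Prop :=
  biadditive sigma
  /\ forall x y, lambda x y * sigma x y * (sigma y x)^-1 = 1.

End Factors.

(* Independence is over duplicate-free finite lists of degrees, so that the last
   two fields together say that A is the direct sum of the [homog g]. *)
Record grading (Gamma : zmodType) (K : fieldType) (A : pzAlgType K) := Grading {
  homog :> Gamma -> {pred A};
  homog_submod : forall g, submod_closed (homog g);
  homog1 : 1 \in homog 0;
  homogM : forall g h a b,
    a \in homog g -> b \in homog h -> a * b \in homog (g + h);
  homog_span : forall a, exists (s : seq Gamma) (f : Gamma -> A),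
    (forall g, f g \in homog g) /\ a = \sum_(g <- s) f g;
  homog_indep : forall (s : seq Gamma) (f : Gamma -> A),
    uniq s -> (forall g, f g \in homog g) ->
    \sum_(g <- s) f g = 0 -> forall g, g \in s -> f g = 0
}.

Definition graded_comm (Gamma : zmodType) (K : fieldType) (A : pzAlgType K)
    (G : grading Gamma A) (lambda : Gamma -> Gamma -> K) : Prop :=
  forall g h a b, a \in G g -> b \in G h -> a * b = lambda g h *: (b * a).

Section Decomposition.
Variables (Gamma : zmodType) (K : fieldType) (A : pzAlgType K).
Variable G : grading Gamma A.

Definition is_decomp (a : A) (s : seq (Gamma * A)) : bool :=
  all (fun p => p.2 \in G p.1) s && (a == \sum_(p <- s) p.2).

Lemma decomp_ex a : exists s, is_decomp a s.
Proof.
have [s [f [fG ->]]] := homog_span G a.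
exists [seq (g, f g) | g <- s]; rewrite /is_decomp big_map eqxx andbT.
by rewrite all_map; apply/allP=> g _ /=.
Qed.

Definition decomp (a : A) : seq (Gamma * A) := xchoose (decomp_ex a).

Lemma decompP a : is_decomp a (decomp a).
Proof. exact: xchooseP. Qed.

Lemma homog_0 g : 0 \in G g. Proof. by case: (homog_submod G g). Qed.
Lemma homogZ g k a : a \in G g -> k *: a \in G g.
Proof.
case: (homog_submod G g) => G0 GL aG.
by have := GL k a 0 aG G0; rewrite addr0.
Qed.
Lemma homogD g a b : a \in G g -> b \in G g -> a + b \in G g.
Proof.
case: (homog_submod G g) => G0 GL aG bG.
by have := GL 1 a b aG bG; rewrite scale1r.
Qed.

(* The linear extension to A of maps [phi g] given on the degree-g parts. *)
Definition hext (V : nmodType) (phi : Gamma -> A -> V) (a : A) : V :=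
  \sum_(p <- decomp a) phi p.1 p.2.

Section Hext.
Variables (V : zmodType) (phi : Gamma -> A -> V).
Hypothesis phiD : forall g, {morph phi g : a b / a + b}.

Let phi0 g : phi g 0 = 0.
Proof. by apply: (addIr (phi g 0)); rewrite -phiD !add0r. Qed.

Lemma hext0_seq (s : seq (Gamma * A)) :
    all (fun p => p.2 \in G p.1) s -> \sum_(p <- s) p.2 = 0 ->
  \sum_(p <- s) phi p.1 p.2 = 0.
Proof.
move=> sG s0; pose t := undup (map fst s).
have part (W : nmodType) (F : Gamma * A -> W) :
  \sum_(p <- s) F p = \sum_(g <- t) \sum_(p <- s | p.1 == g) F p.
  under [RHS]eq_bigr do rewrite big_mkcond /=.
  rewrite exchange_big /= big_seq [RHS]big_seq; apply: eq_bigr => p ps.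
  rewrite (bigD1_seq p.1) ?undup_uniq ?mem_undup ?map_f //= eqxx big1 ?addr0 //.
  by move=> g /negPf; rewrite eq_sym => ->.
have fG g : \sum_(p <- s | p.1 == g) p.2 \in G g.
  rewrite big_seq_cond.
  apply: (big_ind (fun u => u \in G g)) => [||p /andP[ps /eqP <-]].
  - exact: homog_0.
  - by move=> *; apply: homogD.
  - exact: (allP sG).
rewrite part in s0; have f0 := homog_indep (undup_uniq _) fG s0.
rewrite part big_seq big1 // => g /f0 fg0.
under eq_bigr => p /eqP -> do [].
by rewrite -(big_morph (phi g) (phiD g) (phi0 g)) fg0.
Qed.

Lemma hextE a s : is_decomp a s -> hext phi a = \sum_(p <- s) phi p.1 p.2.
Proof.
case/andP: (decompP a) => dG /eqP da /andP[sG /eqP sa].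
have phiN g b : phi g (- b) = - phi g b.
  by apply: (addIr (phi g b)); rewrite -phiD !addNr.
apply/eqP; rewrite -subr_eq0 /hext -sumrN; apply/eqP.
have rG : all (fun p => p.2 \in G p.1) (decomp a ++ [seq (p.1, - p.2) | p <- s]).
  rewrite all_cat dG all_map; apply/allP => p /(allP sG) /= pG.
  by rewrite -scaleN1r homogZ.
have := hext0_seq rG; rewrite !big_cat !big_map /= sumrN -da -sa subrr.
move=> /(_ erefl) e; rewrite -[RHS]e; congr (_ + _).
by apply: eq_bigr => p _; rewrite phiN.
Qed.

Lemma hext_homog g a : a \in G g -> hext phi a = phi g a.
Proof.
move=> aG; rewrite (@hextE a [:: (g, a)]) ?big_seq1 //.
by rewrite /is_decomp /= aG big_seq1 eqxx.
Qed.

Lemma hextD : {morph hext phi : a b / a + b}.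
Proof.
move=> a b; rewrite (@hextE (a + b) (decomp a ++ decomp b)) ?big_cat //.
case/andP: (decompP a) => aG /eqP da; case/andP: (decompP b) => bG /eqP db.
by rewrite /is_decomp all_cat aG bG big_cat /= -da -db eqxx.
Qed.

End Hext.

Lemma homog_ext (V : zmodType) (f h : A -> V) :
    {morph f : a b / a + b} -> {morph h : a b / a + b} ->
    (forall g a, a \in G g -> f a = h a) -> f =1 h.
Proof.
move=> fD hD fh a; have /andP[dG /eqP ->] := decompP a.
have z (k : A -> V) : {morph k : a b / a + b} -> k 0 = 0.
  by move=> kD; apply: (addIr (k 0)); rewrite -kD !add0r.
rewrite (big_morph f fD (z f fD)) (big_morph h hD (z h hD)).
by rewrite big_seq [RHS]big_seq; apply: eq_bigr => p /(allP dG); apply: fh.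
Qed.

End Decomposition.

Section Star.
Variables (Gamma : zmodType) (K : fieldType) (A : pzAlgType K).
Variables (G : grading Gamma A) (sigma : Gamma -> Gamma -> K).

(* The bilinear map sending homogeneous (a, b) of degrees (g, h) to
   sigma g h *: (a * b); see [star_homog]. *)
Definition star (a b : A) : A :=
  hext G (fun g u => hext G (fun h v => sigma g h *: (u * v)) b) a.

Let inD g u : forall h, {morph (fun v : A => sigma g h *: (u * v)) : a b / a + b}.
Proof. by move=> h a b; rewrite mulrDr scalerDr. Qed.

Let outD b g :
  {morph (fun u => hext G (fun h v => sigma g h *: (u * v)) b) : a c / a + c}.
Proof.
move=> a c; rewrite /hext -big_split; apply: eq_bigr => p _ /=.
by rewrite mulrDl scalerDr.
Qed.

Lemma star_homog g h a b :
  a \in G g -> b \in G h -> star a b = sigma g h *: (a * b).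
Proof.
move=> aG bG; rewrite /star (hext_homog (outD b) aG).
by rewrite (hext_homog (inD g a) bG).
Qed.

Lemma starDl : left_distributive star +%R.
Proof. by move=> a c b; rewrite /star (hextD _ (outD b)). Qed.

Lemma starDr : right_distributive star +%R.
Proof.
move=> a b c; rewrite /star [in LHS]/hext [X in _ = X + _]/hext [X in _ = _ + X]/hext.
rewrite -big_split; apply: eq_bigr => p _ /=.
exact: (hextD G (inD p.1 p.2)).
Qed.

Lemma starZl k a b : k *: star a b = star (k *: a) b.
Proof.
move: a; apply: (homog_ext (G := G)) => [a c|a c|g a aG].
- by rewrite starDl scalerDr.
- by rewrite scalerDr starDl.
move: b; apply: (homog_ext (G := G)) => [b c|b c|h b bG].
- by rewrite starDr scalerDr.
- by rewrite starDr.
rewrite (star_homog aG bG) (star_homog (homogZ k aG) bG).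
by rewrite -pzscalerAl !scalerA mulrC.
Qed.

Hypothesis sigmaB : biadditive sigma.

Lemma starA : associative star.
Proof.
case: sigmaB => _ sDl sDr a b c.
move: a; apply: (homog_ext (G := G)) => [a d|a d|g a aG].
- by rewrite starDl.
- by rewrite !starDl.
move: b; apply: (homog_ext (G := G)) => [b d|b d|h b bG].
- by rewrite starDl starDr.
- by rewrite starDr starDl.
move: c; apply: (homog_ext (G := G)) => [c d|c d|k c cG].
- by rewrite !starDr.
- by rewrite starDr.
rewrite (star_homog bG cG) (star_homog aG bG).
rewrite (star_homog aG (homogZ _ (homogM bG cG))).
rewrite (star_homog (homogZ _ (homogM aG bG)) cG).
rewrite -pzscalerAl -pzscalerAr !scalerA mulrA sDl sDr.
by congr (_ *: _); rewrite -!mulrA mulrC -!mulrA; congr (_ * _); rewrite mulrC.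
Qed.

Lemma star1 : left_id 1 star.
Proof.
case: sigmaB => sN sDl _.
apply: (homog_ext (G := G)) => [a b|a b|g a aG] //; first by rewrite starDr.
rewrite (star_homog (homog1 G) aG) mul1r.
suff ->: sigma 0 g = 1 by rewrite scale1r.
by apply: (mulIf (sN 0 g)); rewrite -sDl addr0 mul1r.
Qed.

End Star.

Lemma starC (Gamma : zmodType) (K : fieldType) (A : pzAlgType K)
    (G : grading Gamma A) (lambda sigma : Gamma -> Gamma -> K) :
  graded_comm G lambda -> frakS lambda sigma -> commutative (star G sigma).
Proof.
move=> Gc [[sN _ _] sE] a b.
move: a; apply: (homog_ext (G := G)) => [a c|a c|g a aG].
- by rewrite starDl.
- by rewrite starDr.
move: b; apply: (homog_ext (G := G)) => [b c|b c|h b bG].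
- by rewrite starDr.
- by rewrite starDl.
rewrite (star_homog _ aG bG) (star_homog _ bG aG) (Gc _ _ _ _ aG bG) scalerA.
congr (_ *: _); apply: (mulIf (invr_neq0 (sN h g))).
by rewrite [sigma g h * _]mulrC sE mulfV.
Qed.

(* A with the product [star]. The proofs are arguments of the type because the
   ring structure below needs them. *)
Definition underlined (Gamma : zmodType) (K : fieldType) (A : pzAlgType K)
    (G : grading Gamma A) (lambda sigma : Gamma -> Gamma -> K)
    (Gc : graded_comm G lambda) (sS : frakS lambda sigma) : Type := A.

Section Underlined.
Variables (Gamma : zmodType) (K : fieldType) (A : pzAlgType K).
Variables (G : grading Gamma A) (lambda sigma : Gamma -> Gamma -> K).
Variables (Gc : graded_comm G lambda) (sS : frakS lambda sigma).

Local Notation uA := (underlined Gc sS).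

HB.instance Definition _ := GRing.Lmodule.copy uA A.
HB.instance Definition _ := GRing.Zmodule_isComPzRing.Build uA
  (starA G (proj1 sS)) (starC Gc sS) (star1 G (proj1 sS)) (starDl G sigma).

End Underlined.

Section Matrices.
Variables (Gamma : zmodType) (K : fieldType) (A : pzAlgType K).
Variables (G : grading Gamma A) (n : nat).

Definition homog_mx (nu : 'I_n -> Gamma) (x : Gamma) (X : 'M[A]_n) : Prop :=
  forall i j, X i j \in G (x - nu i + nu j).

Variables (lambda sigma : Gamma -> Gamma -> K).
Variables (Gc : graded_comm G lambda) (sS : frakS lambda sigma).

(* The degree x is an argument: it is not determined by X when X = 0. *)
Definition Jmx (nu : 'I_n -> Gamma) (x : Gamma) (X : 'M[A]_n) :
    'M[underlined Gc sS]_n :=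
  \matrix_(i, j)
    ((sigma x (nu j) * (sigma (nu i) (x - nu i + nu j))^-1) *: X i j).

Definition gamma_det (nu : 'I_n -> Gamma) (x : Gamma) (X : 'M[A]_n) : A :=
  \det (Jmx nu x X).

End Matrices.

Definition invertible (R : pzRingType) (a : R) : Prop :=
  exists b, a * b = 1 /\ b * a = 1.

(* Main.v *)
Require Import Defs.
From mathcomp Require Import all_boot all_order all_algebra.
From mathcomp Require Import perm ring.

Set Implicit Arguments.
Unset Strict Implicit.
Unset Printing Implicit Defensive.

Import GRing.Theory.
Local Open Scope ring_scope.

(** The twist J turns the product of homogeneous matrices of degrees x and y into
    the matrix product over the underlined algebra, up to the scalar
    [sigma x y], and the inverse of a homogeneous element or matrix may be
    replaced by its component of opposite degree. Hence X is invertible iff J(X)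
    is, iff det J(X) is invertible for the product [star], iff it is invertible
    in A, because det J(X) is homogeneous, of degree nx. *)

(** * Biadditive factors and the scalars of the twist J *)

Section BiadditiveFactors.
Variables (Gamma : zmodType) (K : fieldType) (f : Gamma -> Gamma -> K).
Hypothesis fB : biadditive f.

Lemma biadditive0l y : f 0 y = 1.
Proof.
case: fB => fN fDl _.
by apply: (mulfI (fN 0 y)); rewrite -fDl addr0 mulr1.
Qed.

Lemma biadditive0r x : f x 0 = 1.
Proof.
case: fB => fN _ fDr.
by apply: (mulfI (fN x 0)); rewrite -fDr addr0 mulr1.
Qed.

Lemma biadditiveNl x y : f (- x) y = (f x y)^-1.
Proof.
case: fB => fN fDl _.
by apply: (mulfI (fN x y)); rewrite -fDl subrr biadditive0l mulfV.
Qed.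

Lemma biadditiveNr x y : f x (- y) = (f x y)^-1.
Proof.
case: fB => fN _ fDr.
by apply: (mulfI (fN x y)); rewrite -fDr subrr biadditive0r mulfV.
Qed.

(** The scalar of [Jmx] in degree [x], with [i] and [j] standing for the degrees [nu i] and
    [nu j]. *)
Definition twist (x i j : Gamma) : K := f x j * (f i (x - i + j))^-1.

Lemma twist_neq0 x i j : twist x i j != 0.
Proof. by case: fB => fN _ _; rewrite mulf_neq0 // invr_neq0. Qed.

Lemma twist0 i : twist 0 i i = 1.
Proof. by rewrite /twist add0r addNr biadditive0l biadditive0r invr1 mulr1. Qed.

(** The first factor is what [star] inserts when the entries (i, j) and (j, k) are multiplied. The
    right-hand side is free of [j], so it can leave the sum in a matrix product. *)
Lemma twistM x y i j k :
  f (x - i + j) (y - j + k) * (twist x i j * twist y j k)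
  = f x y * twist (x + y) i k.
Proof.
case: fB => fN fDl fDr.
rewrite /twist !(fDl, fDr, biadditiveNl, biadditiveNr).
by field; rewrite !fN.
Qed.

End BiadditiveFactors.

Lemma degree_mul (Gamma : zmodType) (x y i j k : Gamma) :
  (x - i + j) + (y - j + k) = x + y - i + k.
Proof. by rewrite (addrC y) !addrA addrK [x - i + y]addrAC. Qed.

(** * Homogeneous components of elements and matrices *)

Section Components.
Variables (Gamma : zmodType) (K : fieldType) (A : pzAlgType K).
Variable G : grading Gamma A.

Definition component (g : Gamma) : A -> A :=
  hext G (fun (h : Gamma) (u : A) => if h == g then u else 0).

Let selD (g h : Gamma) : {morph (fun u : A => if h == g then u else 0) : a b / a + b}.
Proof. by move=> a b; case: eqP; rewrite ?addr0. Qed.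

Lemma componentD g : {morph component g : a b / a + b}.
Proof. exact: hextD (selD g). Qed.

Lemma component0 g : component g 0 = 0.
Proof. by apply: (addIr (component g 0)); rewrite -componentD !add0r. Qed.

Lemma component_sum g (I : Type) (r : seq I) (P : pred I) (F : I -> A) :
  component g (\sum_(i <- r | P i) F i) = \sum_(i <- r | P i) component g (F i).
Proof. exact: (big_morph _ (componentD g) (component0 g)). Qed.

Lemma component_homog g h a :
  a \in G h -> component g a = if h == g then a else 0.
Proof. exact: (hext_homog (selD g)). Qed.

Lemma component_in g a : component g a \in G g.
Proof.
have /andP[dG /eqP ->] := decompP G a.
rewrite component_sum big_seq; apply: (big_ind (fun u => u \in G g)).
- exact: homog_0.
- by move=> *; apply: homogD.
- move=> p /(allP dG) pG; rewrite (component_homog g pG).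
  by case: eqP => [<-|_] //; apply: homog_0.
Qed.

(** * Graded products, kept abstract to cover both the product of [A] and [star] *)

Section GradedProduct.
Variable op : A -> A -> A.
Hypothesis opDl : left_distributive op +%R.
Hypothesis opDr : right_distributive op +%R.
Hypothesis op_homog :
  forall g h a b, a \in G g -> b \in G h -> op a b \in G (g + h).

(** Multiplication by [a] shifts every degree by [g], and this shift is injective, so only the
    degree-[h] part of [b] reaches degree [g + h]. *)
Lemma component_opl g h a b :
  a \in G g -> component (g + h) (op a b) = op a (component h b).
Proof.
move=> aG; move: b; apply: (homog_ext (G := G)) => [b c|b c|k b bG].
- by rewrite opDr componentD.
- by rewrite componentD opDr.
have op0 : op a 0 = 0 by apply: (addIr (op a 0)); rewrite -opDr !add0r.
rewrite (component_homog _ (op_homog aG bG)).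
rewrite (component_homog _ bG) (inj_eq (addrI g)).
by case: eqP.
Qed.

Lemma component_opr g h a b :
  b \in G h -> component (g + h) (op a b) = op (component g a) b.
Proof.
move=> bG; move: a; apply: (homog_ext (G := G)) => [a c|a c|k a aG].
- by rewrite opDl componentD.
- by rewrite componentD opDl.
have op0 : op 0 b = 0 by apply: (addIr (op 0 b)); rewrite -opDl !add0r.
rewrite (component_homog _ (op_homog aG bG)).
rewrite (component_homog _ aG) (inj_eq (addIr h)).
by case: eqP.
Qed.

Section MatrixEntries.
Variables (n : nat) (nu : 'I_n -> Gamma) (x : Gamma) (i k : 'I_n).
Variables u v : 'I_n -> A.

(** The sum is an entry of a matrix product whose left factor has degree [x]. Taking its part of
    matrix degree 0 amounts to taking the part of degree [- x] of the right factor. *)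
Lemma component_sum_opl : (forall j, u j \in G (x - nu i + nu j)) ->
  component (- nu i + nu k) (\sum_j op (u j) (v j))
  = \sum_j op (u j) (component (- x - nu j + nu k) (v j)).
Proof.
move=> uG; rewrite component_sum; apply: eq_bigr => j _.
rewrite -(component_opl _ _ (uG j)); congr (component _ _).
by rewrite degree_mul subrr sub0r.
Qed.

Lemma component_sum_opr : (forall j, v j \in G (x - nu j + nu k)) ->
  component (- nu i + nu k) (\sum_j op (u j) (v j))
  = \sum_j op (component (- x - nu i + nu j) (u j)) (v j).
Proof.
move=> vG; rewrite component_sum; apply: eq_bigr => j _.
rewrite -(component_opr _ _ (vG j)); congr (component _ _).
by rewrite degree_mul addNr sub0r.
Qed.

End MatrixEntries.
End GradedProduct.

(** The projection of all matrices onto the homogeneous ones of degree [x]. *)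
Definition component_mx n (nu : 'I_n -> Gamma) x (X : 'M[A]_n) : 'M[A]_n :=
  \matrix_(i, j) component (x - nu i + nu j) (X i j).

Lemma component_mx_homog n (nu : 'I_n -> Gamma) x X :
  homog_mx G nu x (component_mx nu x X).
Proof. by move=> i j; rewrite mxE component_in. Qed.

Lemma component_mx1 n (nu : 'I_n -> Gamma) : component_mx nu 0 1%:M = 1%:M.
Proof.
apply/matrixP => i k; rewrite !mxE; have [->|_] := eqVneq i k.
  by rewrite sub0r addNr (component_homog _ (homog1 G)) eqxx.
by rewrite component0.
Qed.

(** The identity matrix is homogeneous of degree 0, so projecting both sides of the hypothesis to
    degree 0 changes only [Y]. *)
Lemma mulmx1_component n (nu : 'I_n -> Gamma) x (X Y : 'M[A]_n) :
  homog_mx G nu x X -> X *m Y = 1%:M -> X *m component_mx nu (- x) Y = 1%:M.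
Proof.
move=> XG XY; rewrite -(component_mx1 nu) -XY; apply/matrixP => i k.
rewrite !mxE sub0r.
rewrite (component_sum_opl (@mulrDr A) (@homogM _ _ _ G) k (Y^~ k) (XG i)).
by apply: eq_bigr => j _; rewrite mxE.
Qed.
Lemma component_mulmx1 n (nu : 'I_n -> Gamma) x (X Y : 'M[A]_n) :
  homog_mx G nu x X -> Y *m X = 1%:M -> component_mx nu (- x) Y *m X = 1%:M.
Proof.
move=> XG YX; rewrite -(component_mx1 nu) -YX; apply/matrixP => i k.
rewrite !mxE sub0r.
rewrite (component_sum_opr (@mulrDl A) (@homogM _ _ _ G) i (Y i) (XG^~ k)).
by apply: eq_bigr => j _; rewrite mxE.
Qed.

End Components.

(** Multiplicativity of the determinant gives one direction, the adjugate the other. A one-sided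
    inverse of the determinant suffices by commutativity. *)
Lemma invertible_mxP (R : comPzRingType) n (M : 'M[R]_n) :
  invertible M <-> exists b, \det M * b = 1.
Proof.
split=> [[Z [MZ _]]|[b Mb]].
  by exists (\det Z); rewrite -det_mulmx (MZ : M *m Z = 1%:M) det1.
exists (\adj M *m b%:M); split.
  by rewrite [LHS]mulmxA mul_mx_adj -scalar_mxM Mb.
rewrite scalar_mxC; change (b%:M *m \adj M *m M = 1%:M).
by rewrite -mulmxA mul_adj_mx -scalar_mxM mulrC Mb.
Qed.

(** * Homogeneous elements under [star] *)

Section Star.
Variables (Gamma : zmodType) (K : fieldType) (A : pzAlgType K).
Variables (G : grading Gamma A) (lambda sigma : Gamma -> Gamma -> K).
Variables (Gc : graded_comm G lambda) (sS : frakS lambda sigma).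
Hypothesis lambda_cf : commutation_factor lambda.

Local Notation uA := (underlined Gc sS).

Lemma star_in g h a b :
  a \in G g -> b \in G h -> star G sigma a b \in G (g + h).
Proof. by move=> aG bG; rewrite (star_homog _ aG bG) homogZ ?homogM. Qed.

Lemma starZr k (a b : uA) : k *: (a * b) = a * (k *: b).
Proof. by rewrite mulrC [RHS]mulrC; apply: starZl. Qed.

(** An inverse for either product may be projected to degree [- g], where the two products with [a]
    differ by the nonzero scalar [sigma g (- g)]. *)
Lemma homog_invertibleP g (a : A) : a \in G g ->
  invertible a <-> exists b, star G sigma a b = 1.
Proof.
case: (sS) => [[sN _ _] _] aG; split=> [[b [ab _]]|[b ab]].
- have ab' : a * component G (- g) b = 1.
    rewrite -(component_opl (@mulrDr A) (@homogM _ _ _ G) _ _ aG).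
    by rewrite ab subrr (component_homog _ (homog1 G)) eqxx.
  exists ((sigma g (- g))^-1 *: component G (- g) b).
  rewrite (star_homog _ aG (homogZ _ (component_in G _ b))).
  by rewrite -pzscalerAr ab' scalerA mulfV ?scale1r.
- pose c := component G (- g) b.
  have cG : c \in G (- g) by apply: component_in.
  have ac : a * (sigma g (- g) *: c) = 1.
    rewrite -pzscalerAr -(star_homog _ aG cG).
    rewrite -(component_opl (starDr G sigma) star_in _ _ aG).
    by rewrite ab subrr (component_homog _ (homog1 G)) eqxx.
  have [[lN _ _] _] := lambda_cf.
  (* Graded commutativity gives [a] a left inverse as well, at the cost of [lambda g (- g)]. Having
     both, the right inverse from [ac] is two-sided. *)
  have ca : (lambda g (- g) * sigma g (- g)) *: (c * a) = 1.
    by rewrite mulrC -scalerA -(Gc aG cG) pzscalerAr.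
  exists (sigma g (- g) *: c); split=> //.
  rewrite -[LHS]mul1r -[in LHS]ca pzscalerAl -mulrA [a * _]mulrA ac mul1r.
  by rewrite -pzscalerAl.
Qed.

Lemma prod_homog (I : finType) (d : I -> Gamma) (F : I -> uA) :
  (forall i, (F i : A) \in G (d i)) ->
  ((\prod_i F i : uA) : A) \in G (\sum_i d i).
Proof.
move=> FG; apply: (big_ind2 (fun (u : uA) g => (u : A) \in G g)) => //.
- exact: homog1.
- by move=> u g v h; apply: star_in.
Qed.

(** In the term of a permutation [s], the degrees [nu (s i)] are the [nu i] reordered, so they
    cancel in the sum and [x] is left [n] times. *)
Lemma det_homog n (nu : 'I_n -> Gamma) x (M : 'M[uA]_n) :
  homog_mx G nu x M -> ((\det M : uA) : A) \in G (x *+ n).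
Proof.
move=> MG; apply: (big_ind (fun u : uA => (u : A) \in G _)).
- exact: homog_0.
- by move=> u v; apply: homogD.
move=> s _; have sG : ((\prod_i M i (s i) : uA) : A) \in G (x *+ n).
  suff -> : x *+ n = \sum_i (x - nu i + nu (s i)) by apply: prod_homog.
  rewrite big_split sumrB /= sumr_const card_ord.
  by rewrite (reindex_inj (@perm_inj _ s)) /= subrK.
rewrite mulr_sign; case: (s : bool) => //.
by rewrite -scaleN1r homogZ.
Qed.

(** * The twist J and invertibility of matrices *)

Section Twist.
Variables (n : nat) (nu : 'I_n -> Gamma).

Lemma Jmx_homog x (X : 'M[A]_n) :
  homog_mx G nu x X -> homog_mx G nu x (Jmx Gc sS nu x X).
Proof. by move=> XG i j; rewrite mxE homogZ. Qed.

(** The right-hand side is [sigma x y] times an entry of J(XY). The form is entrywise because the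
    two matrix products are over different rings. *)
Lemma JmxM x y (X Y : 'M[A]_n) i k :
  homog_mx G nu x X -> homog_mx G nu y Y ->
  (Jmx Gc sS nu x X *m Jmx Gc sS nu y Y) i k
  = (sigma x y * twist sigma (x + y) (nu i) (nu k)) *: (X *m Y) i k :> A.
Proof.
move=> XG YG; rewrite !mxE scaler_sumr; apply: eq_bigr => j _; rewrite !mxE.
(* The product of [underlined] is [star] by conversion; naming it lets [star_homog] apply. *)
transitivity (star G sigma (twist sigma x (nu i) (nu j) *: X i j)
  (twist sigma y (nu j) (nu k) *: Y j k)); first by [].
rewrite (star_homog _ (homogZ _ (XG i j)) (homogZ _ (YG j k))).
rewrite -pzscalerAl -pzscalerAr !scalerA -(twistM (proj1 sS) _ _ _ (nu j)).
by rewrite mulrA.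
Qed.

Lemma mulmx1_component_star x (M Z : 'M[uA]_n) :
  homog_mx G nu x M -> M *m Z = 1%:M ->
  M *m (component_mx G nu (- x) Z : 'M[uA]_n) = 1%:M.
Proof.
(* The unit of [star] is that of [A], so the two identity matrices are convertible. *)
move=> MG MZ; rewrite -(component_mx1 G nu : _ = (1%:M : 'M[uA]_n)) -MZ.
apply/matrixP => i k; rewrite !mxE sub0r.
rewrite (component_sum_opl (starDr G sigma) star_in k (Z^~ k) (MG i)).
by apply: eq_bigr => j _; rewrite mxE.
Qed.

Lemma component_star_mulmx1 x (M Z : 'M[uA]_n) :
  homog_mx G nu x M -> Z *m M = 1%:M ->
  (component_mx G nu (- x) Z : 'M[uA]_n) *m M = 1%:M.
Proof.
move=> MG ZM; rewrite -(component_mx1 G nu : _ = (1%:M : 'M[uA]_n)) -ZM.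
apply/matrixP => i k; rewrite !mxE sub0r.
rewrite (component_sum_opr (starDl G sigma) star_in i (Z i) (MG^~ k)).
by apply: eq_bigr => j _; rewrite mxE.
Qed.

(* [sigma x x] cancels the factors [sigma x (- x)] and [sigma (- x) x] of [JmxM]. *)
Definition Jmx_opp x (Y : 'M[A]_n) : 'M[uA]_n :=
  map_mx (fun a : uA => sigma x x *: a) (Jmx Gc sS nu (- x) Y).

(** The scalars are nonzero, hence cancel, and equal 1 on the diagonal, hence fix the identity
    matrix. *)
Lemma twist_scalar_mx (M : 'M[uA]_n) (P : 'M[A]_n) :
  (forall i k, M i k = twist sigma 0 (nu i) (nu k) *: P i k :> A) ->
  M = 1%:M <-> P = 1%:M.
Proof.
move=> MP; have sB := proj1 sS.
have tw1 i k : twist sigma 0 (nu i) (nu k) *: (1%:M i k : A) = (1%:M i k : A).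
  rewrite mxE; have [->|_] := eqVneq i k; last exact: scaler0.
  by rewrite twist0 ?scale1r.
split=> E; apply/matrixP => i k.
  by apply: (scalerI (twist_neq0 sB 0 (nu i) (nu k))); rewrite tw1 -MP E !mxE.
by rewrite MP E tw1 !mxE.
Qed.

Lemma mul_Jmx_opp1 x (X Y : 'M[A]_n) :
  homog_mx G nu x X -> homog_mx G nu (- x) Y ->
  Jmx Gc sS nu x X *m Jmx_opp x Y = 1%:M <-> X *m Y = 1%:M.
Proof.
move=> XG YG; apply: twist_scalar_mx => i k; have sB := proj1 sS.
have -> : (Jmx Gc sS nu x X *m Jmx_opp x Y) i k
  = sigma x x *: (Jmx Gc sS nu x X *m Jmx Gc sS nu (- x) Y) i k :> A.
  rewrite [LHS]mxE [in RHS]mxE scaler_sumr; apply: eq_bigr => j _.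
  rewrite [Jmx_opp x Y _ _]mxE; exact/esym/starZr.
rewrite (JmxM _ _ XG YG) scalerA mulrA subrr (biadditiveNr sB) mulfV ?mul1r //.
by case: sB.
Qed.

Lemma mul_opp_Jmx1 x (X Y : 'M[A]_n) :
  homog_mx G nu x X -> homog_mx G nu (- x) Y ->
  Jmx_opp x Y *m Jmx Gc sS nu x X = 1%:M <-> Y *m X = 1%:M.
Proof.
move=> XG YG; apply: twist_scalar_mx => i k; have sB := proj1 sS.
have -> : (Jmx_opp x Y *m Jmx Gc sS nu x X) i k
  = sigma x x *: (Jmx Gc sS nu (- x) Y *m Jmx Gc sS nu x X) i k :> A.
  rewrite [LHS]mxE [in RHS]mxE scaler_sumr; apply: eq_bigr => j _.
  rewrite [Jmx_opp x Y _ _]mxE; exact/esym/starZl.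
rewrite (JmxM _ _ YG XG) scalerA mulrA addNr (biadditiveNl sB) mulfV ?mul1r //.
by case: sB.
Qed.

(** Each entry is only rescaled by a nonzero [c i j]. This pulls an inverse of J(X) back to a matrix
    over [A]. *)
Lemma Jmx_opp_surj x (Z : 'M[A]_n) : homog_mx G nu (- x) Z ->
  exists2 Y, homog_mx G nu (- x) Y & Jmx_opp x Y = Z.
Proof.
move=> ZG; have sB := proj1 sS.
pose c i j := sigma x x * twist sigma (- x) (nu i) (nu j).
have cN i j : c i j != 0.
  by rewrite mulf_neq0 ?twist_neq0 //; case: sB.
exists (\matrix_(i, j) ((c i j)^-1 *: Z i j)) => [i j|].
  by rewrite mxE homogZ.
apply/matrixP => i j; rewrite !mxE !scalerA mulfV ?scale1r //; exact: cN.
Qed.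

(** [JmxM] controls products of homogeneous matrices only, so each inverse is projected to degree
    [- x] before it is carried across. *)
Lemma invertible_JmxP x (X : 'M[A]_n) : homog_mx G nu x X ->
  invertible X <-> invertible (Jmx Gc sS nu x X).
Proof.
move=> XG; split=> [[Y [XY YX]]|[Z [XZ ZX]]].
- have Y'G := component_mx_homog G nu (- x) Y.
  exists (Jmx_opp x (component_mx G nu (- x) Y)); split.
    by apply/(mul_Jmx_opp1 XG Y'G); apply: mulmx1_component.
  by apply/(mul_opp_Jmx1 XG Y'G); apply: component_mulmx1.
- have JG := Jmx_homog XG.
  have [Y YG YZ] := Jmx_opp_surj (component_mx_homog G nu (- x) Z).
  exists Y; split.
    by apply/(mul_Jmx_opp1 XG YG); rewrite YZ; apply: mulmx1_component_star.
  by apply/(mul_opp_Jmx1 XG YG); rewrite YZ; apply: component_star_mulmx1.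
Qed.

End Twist.
End Star.

Theorem proposition6p2 (K : fieldType) (K0 : [pchar K] =i pred0)
    (Gamma : zmodType) (Gamma_fg : fin_gen Gamma)
    (lambda : Gamma -> Gamma -> K) (lambda_cf : commutation_factor lambda)
    (lambda_even : forall x, lambda x x = 1)
    (A : pzAlgType K) (G : grading Gamma A) (Gc : graded_comm G lambda)
    (sigma : Gamma -> Gamma -> K) (sS : frakS lambda sigma)
    (n : nat) (nu : 'I_n -> Gamma) (x : Gamma)
    (X : 'M[A]_n) (XM : homog_mx G nu x X) :
  invertible X <-> invertible (gamma_det Gc sS nu x X).
Proof.
have XJ := Jmx_homog Gc sS XM.
rewrite (invertible_JmxP Gc sS XM) invertible_mxP.
(* The inverse of the determinant in [invertible_mxP] is taken in [underlined], that is, for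
   [star]. *)
by symmetry; apply: (homog_invertibleP Gc sS lambda_cf (det_homog XJ)).
Qed.
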